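(* Distinct elements of $\mathcal N=\{f_I\}\cup\{f_{II}^b:b\in\mathbb C\}$ are not equivalent (i.e. do not lie in the same orbit) under the action of $\mathrm{Aut}(A_1)\times\mathrm{Aut}(\mathfrak{sl}(2))$ on $A_1^{\mathfrak{sl}(2)}$.
   Context: The Weyl algebra $A_1$ is the complex associative unital algebra generated by $p,q$ with $pq-qp=1$, with Lie bracket $[a,b]=ab-ba$. $A_1^{\mathfrak{sl}(2)}$ is the set of injective Lie algebra homomorphisms $\mathfrak{sl}(2)=\mathfrak{sl}(2,\mathbb C)\to A_1$. The group $\mathrm{Aut}(A_1)\times\mathrm{Aut}(\mathfrak{sl}(2))$ acts on it by $(\alpha,w)\cdot f=\alpha\circ f\circ w^{-1}$. Let $e_+=\begin{pmatrix}0&1\\0&0\end{pmatrix}$, $e_-=\begin{pmatrix}0&0\\1&0\end{pmatrix}$, $e_0=\begin{pmatrix}1&0\\0&-1\end{pmatrix}$. The elements $f_I,f_{II}^b\in A_1^{\mathfrak{sl}(2)}$ ($b\in\mathbb C$) are defined by $f_I(e_+)=-\frac12q^2$, $f_I(e_-)=\frac12p^2$, $f_I(e_0)=\frac12(pq+qp)$; $f_{II}^b(e_+)=(b+pq)q$, $f_{II}^b(e_-)=-p$, $f_{II}^b(e_0)=2pq+b$. *)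

(* Defs.v *)
From HB Require Import structures.
From mathcomp Require Import all_boot all_order all_algebra.
From mathcomp Require Import boolp classical_sets reals.
From mathcomp Require Import complex ring.

Set Implicit Arguments.
Unset Strict Implicit.
Unset Printing Implicit Defensive.

Import GRing.Theory Num.Theory.
Local Open Scope ring_scope.
Local Open Scope quotient_scope.
Local Open Scope classical_set_scope.

(** * The Weyl algebra

    [weyl K] is the associative unital [K]-algebra presented by two generators
    [p], [q] and the single relation [p q - q p = 1]: formal expressions in the
    generators and the scalars, modulo the smallest congruence containing the
    axioms of associative unital [K]-algebras and the defining relation.
    [weyl_lift_exists] and [weyl_lift_unique] state the corresponding universal
    property. *)

Inductive wterm (K : Type) : Type :=
| WScal of K
| WP
| WQ
| WAdd of wterm K & wterm K
| WMul of wterm K & wterm K.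
Arguments WP {K}.
Arguments WQ {K}.

Inductive weq (K : fieldType) : wterm K -> wterm K -> Prop :=
| weq_refl t : weq t t
| weq_sym s t : weq s t -> weq t s
| weq_trans s t u : weq s t -> weq t u -> weq s u
| weq_add s s' t t' : weq s s' -> weq t t' -> weq (WAdd s t) (WAdd s' t')
| weq_mul s s' t t' : weq s s' -> weq t t' -> weq (WMul s t) (WMul s' t')
| weq_addA s t u : weq (WAdd s (WAdd t u)) (WAdd (WAdd s t) u)
| weq_addC s t : weq (WAdd s t) (WAdd t s)
| weq_add0 t : weq (WAdd (WScal 0) t) t
| weq_addN t : weq (WAdd (WMul (WScal (-1)) t) t) (WScal 0)
| weq_mulA s t u : weq (WMul s (WMul t u)) (WMul (WMul s t) u)
| weq_mul1l t : weq (WMul (WScal 1) t) t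
| weq_mul1r t : weq (WMul t (WScal 1)) t
| weq_mulDl s t u : weq (WMul (WAdd s t) u) (WAdd (WMul s u) (WMul t u))
| weq_mulDr s t u : weq (WMul s (WAdd t u)) (WAdd (WMul s t) (WMul s u))
| weq_scalD a b : weq (WScal (a + b)) (WAdd (WScal a) (WScal b))
| weq_scalM a b : weq (WScal (a * b)) (WMul (WScal a) (WScal b))
| weq_scalC a t : weq (WMul (WScal a) t) (WMul t (WScal a))
| weq_weyl : weq (WAdd (WMul WP WQ) (WMul (WScal (-1)) (WMul WQ WP))) (WScal 1).

HB.instance Definition _ (K : Type) := gen_eqMixin (wterm K).
HB.instance Definition _ (K : Type) := gen_choiceMixin (wterm K).

Section WeylQuotient.
Variable K : fieldType.

Definition weqb (s t : wterm K) : bool := `[< weq s t >].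

Fact weqb_refl : reflexive weqb.
Proof. by move=> t; apply/asboolP; apply: weq_refl. Qed.

Fact weqb_sym : symmetric weqb.
Proof. by move=> s t; apply/asboolP/asboolP; apply: weq_sym. Qed.

Fact weqb_trans : transitive weqb.
Proof.
by move=> t s u /asboolP st /asboolP tu; apply/asboolP; apply: weq_trans tu.
Qed.

Canonical weqb_equiv := EquivRel weqb weqb_refl weqb_sym weqb_trans.

Definition weyl := {eq_quot weqb}.
HB.instance Definition _ := Choice.on weyl.
HB.instance Definition _ := EqQuotient.on weyl.

Lemma weyl_eqP (s t : wterm K) : weq s t <-> \pi_weyl s = \pi_weyl t.
Proof.
split=> [st|/eqmodP /asboolP //].
by apply/eqmodP/asboolP.
Qed.

Lemma weq_repr (t : wterm K) : weq (repr (\pi_weyl t)) t.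
Proof. by apply/weyl_eqP; rewrite reprK. Qed.

Definition wscal (c : K) : weyl := \pi_weyl (WScal c).
Definition wadd (a b : weyl) : weyl := \pi_weyl (WAdd (repr a) (repr b)).
Definition wmul (a b : weyl) : weyl := \pi_weyl (WMul (repr a) (repr b)).

Definition weyl_p : weyl := \pi_weyl WP.
Definition weyl_q : weyl := \pi_weyl WQ.

Lemma waddE s t : wadd (\pi_weyl s) (\pi_weyl t) = \pi_weyl (WAdd s t).
Proof. by apply/weyl_eqP/weq_add; apply: weq_repr. Qed.

Lemma wmulE s t : wmul (\pi_weyl s) (\pi_weyl t) = \pi_weyl (WMul s t).
Proof. by apply/weyl_eqP/weq_mul; apply: weq_repr. Qed.

Lemma weyl_reprP (P : weyl -> Prop) : (forall t, P (\pi_weyl t)) -> forall a, P a.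
Proof. by move=> Ppi a; rewrite -[a]reprK. Qed.

Lemma waddA : associative wadd.
Proof.
elim/weyl_reprP=> s; elim/weyl_reprP=> t; elim/weyl_reprP=> u.
by rewrite !waddE; apply/weyl_eqP/weq_addA.
Qed.

Lemma waddC : commutative wadd.
Proof.
elim/weyl_reprP=> s; elim/weyl_reprP=> t.
by rewrite !waddE; apply/weyl_eqP/weq_addC.
Qed.

Lemma wadd0 : left_id (wscal 0) wadd.
Proof. by elim/weyl_reprP=> t; rewrite waddE; apply/weyl_eqP/weq_add0. Qed.

Lemma waddN : left_inverse (wscal 0) (wmul (wscal (-1))) wadd.
Proof.
by elim/weyl_reprP=> t; rewrite wmulE waddE; apply/weyl_eqP/weq_addN.
Qed.

HB.instance Definition _ := GRing.isZmodule.Build weyl waddA waddC wadd0 waddN.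

Lemma wmulA : associative wmul.
Proof.
elim/weyl_reprP=> s; elim/weyl_reprP=> t; elim/weyl_reprP=> u.
by rewrite !wmulE; apply/weyl_eqP/weq_mulA.
Qed.

Lemma wmul1l : left_id (wscal 1) wmul.
Proof. by elim/weyl_reprP=> t; rewrite wmulE; apply/weyl_eqP/weq_mul1l. Qed.

Lemma wmul1r : right_id (wscal 1) wmul.
Proof. by elim/weyl_reprP=> t; rewrite wmulE; apply/weyl_eqP/weq_mul1r. Qed.

Lemma wmulDl : left_distributive wmul +%R.
Proof.
elim/weyl_reprP=> s; elim/weyl_reprP=> t; elim/weyl_reprP=> u.
rewrite -![_ + _]/(wadd _ _) !(waddE, wmulE).
exact/weyl_eqP/weq_mulDl.
Qed.

Lemma wmulDr : right_distributive wmul +%R.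
Proof.
elim/weyl_reprP=> s; elim/weyl_reprP=> t; elim/weyl_reprP=> u.
rewrite -![_ + _]/(wadd _ _) !(waddE, wmulE).
exact/weyl_eqP/weq_mulDr.
Qed.

HB.instance Definition _ :=
  GRing.Zmodule_isPzRing.Build weyl wmulA wmul1l wmul1r wmulDl wmulDr.

(** The action of differential operators on polynomials ([p] by [d/dX], [q] by
    multiplication by [X]); it shows in particular that [weyl K] is not the
    zero ring. *)
Fixpoint wrep (t : wterm K) : {poly K} -> {poly K} :=
  match t with
  | WScal c => fun f => c *: f
  | WP => fun f => f^`()
  | WQ => fun f => 'X * f
  | WAdd s u => fun f => wrep s f + wrep u f
  | WMul s u => fun f => wrep s (wrep u f)
  end.

Lemma wrep_linear t : linear (wrep t).
Proof.
elim: t => [c|||s IHs u IHu|s IHs u IHu] a f g /=.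
- by rewrite scalerDr !scalerA mulrC.
- by rewrite derivD derivZ.
- by rewrite mulrDr scalerAr.
- by rewrite IHs IHu scalerDr addrACA.
- by rewrite IHu IHs.
Qed.

HB.instance Definition _ t :=
  GRing.isLinear.Build K {poly K} {poly K} *:%R (wrep t) (wrep_linear t).

Lemma wrep_weq s t : weq s t -> wrep s =1 wrep t.
Proof.
elim=> {s t} //=.
- by move=> s t _ st f.
- by move=> s t u _ st _ tu f; rewrite st.
- by move=> s s' t t' _ ss' _ tt' f; rewrite ss' tt'.
- by move=> s s' t t' _ ss' _ tt' f; rewrite tt' ss'.
- by move=> s t u f; rewrite addrA.
- by move=> s t f; rewrite addrC.
- by move=> t f; rewrite scale0r add0r.
- by move=> t f; rewrite scale0r scaleN1r addNr.
- by move=> t f; rewrite scale1r.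
- by move=> t f; rewrite scale1r.
- by move=> s t u f; rewrite linearD.
- by move=> a b f; rewrite scalerDl.
- by move=> a b f; rewrite scalerA.
- by move=> a t f; rewrite linearZ.
- move=> f; rewrite derivM derivX mul1r scaleN1r scale1r.
  by rewrite addrK.
Qed.

Definition weyl_act (a : weyl) (f : {poly K}) : {poly K} := wrep (repr a) f.

Lemma weyl_act_pi t f : weyl_act (\pi_weyl t) f = wrep t f.
Proof. exact/wrep_weq/weq_repr. Qed.

Fact weyl_oner_neq0 : (1 : weyl) != 0.
Proof.
apply/eqP=> /(congr1 (weyl_act^~ 1)) /=.
rewrite -[1]/(wscal 1) -[0]/(wscal 0) !weyl_act_pi /= scale1r scale0r.
by move/eqP; rewrite oner_eq0.
Qed.

HB.instance Definition _ := GRing.PzSemiRing_isNonZero.Build weyl weyl_oner_neq0.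

Definition wscale (c : K) (a : weyl) : weyl := wscal c * a.

Lemma wscalD a b : wscal (a + b) = wscal a + wscal b.
Proof. by rewrite -[RHS]/(wadd _ _) waddE; apply/weyl_eqP/weq_scalD. Qed.

Lemma wscalM a b : wscal (a * b) = wscal a * wscal b.
Proof. by rewrite -[RHS]/(wmul _ _) wmulE; apply/weyl_eqP/weq_scalM. Qed.

Lemma wscalC c (a : weyl) : wscal c * a = a * wscal c.
Proof.
elim/weyl_reprP: a => t; rewrite -![_ * _]/(wmul _ _) !wmulE.
exact/weyl_eqP/weq_scalC.
Qed.

Fact wscaleA a b v : wscale a (wscale b v) = wscale (a * b) v.
Proof. by rewrite /wscale wscalM mulrA. Qed.

Fact wscale1 : left_id 1 wscale.
Proof. exact: mul1r. Qed.

Fact wscaleDr : right_distributive wscale +%R.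
Proof. by move=> c a b; apply: mulrDr. Qed.

Fact wscaleDl v : {morph wscale^~ v : a b / a + b}.
Proof. by move=> a b; rewrite /wscale wscalD mulrDl. Qed.

HB.instance Definition _ := GRing.Zmodule_isLmodule.Build K weyl
  wscaleA wscale1 wscaleDr wscaleDl.

Fact wscaleAl (c : K) (a b : weyl) : c *: (a * b) = (c *: a) * b.
Proof. exact: mulrA. Qed.

HB.instance Definition _ := GRing.Lmodule_isLalgebra.Build K weyl wscaleAl.

Fact wscaleAr (c : K) (a b : weyl) : c *: (a * b) = a * (c *: b).
Proof. by rewrite -[LHS]/(wscal c * _) mulrA wscalC -mulrA. Qed.

HB.instance Definition _ := GRing.Lalgebra_isAlgebra.Build K weyl wscaleAr.

Lemma weyl_relation : weyl_p * weyl_q - weyl_q * weyl_p = 1.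
Proof.
rewrite -[- _]/(wmul (wscal (-1)) _) -![_ * _]/(wmul _ _) -[_ + _]/(wadd _ _).
by rewrite /weyl_p /weyl_q /wscal !wmulE waddE; apply/weyl_eqP; apply: weq_weyl.
Qed.

Lemma weyl_ind (P : weyl -> Prop) :
  (forall c : K, P c%:A) -> P weyl_p -> P weyl_q ->
  (forall a b, P a -> P b -> P (a + b)) ->
  (forall a b, P a -> P b -> P (a * b)) -> forall a, P a.
Proof.
move=> Pc Pp Pq PD PM; elim/weyl_reprP; elim=> [c|||s Ps t Pt|s Ps t Pt] //.
- by have := Pc c; rewrite -[c%:A]/(wscal c * 1) mulr1.
- by rewrite -waddE; apply: PD.
- by rewrite -wmulE; apply: PM.
Qed.

Lemma weyl_actD a b f : weyl_act (a + b) f = weyl_act a f + weyl_act b f.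
Proof. by rewrite -[a + b]/(wadd _ _) weyl_act_pi. Qed.

Lemma weyl_actM a b f : weyl_act (a * b) f = weyl_act a (weyl_act b f).
Proof. by rewrite -[a * b]/(wmul _ _) weyl_act_pi. Qed.

Lemma weyl_actZ c a f : weyl_act (c *: a) f = c *: weyl_act a f.
Proof. by rewrite -[c *: a]/(wscal c * a) weyl_actM weyl_act_pi. Qed.

Lemma weyl_act_p f : weyl_act weyl_p f = f^`().
Proof. by rewrite weyl_act_pi. Qed.

Lemma weyl_act_q f : weyl_act weyl_q f = 'X * f.
Proof. by rewrite weyl_act_pi. Qed.

Lemma weyl_act0 f : weyl_act 0 f = 0.
Proof. by rewrite weyl_act_pi /= scale0r. Qed.

Section UniversalProperty.
Variables (B : algType K) (x y : B).

Fixpoint weval (t : wterm K) : B :=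
  match t with
  | WScal c => c%:A
  | WP => x
  | WQ => y
  | WAdd s u => weval s + weval u
  | WMul s u => weval s * weval u
  end.

Lemma weval_weq : x * y - y * x = 1 ->
  forall s t, weq s t -> weval s = weval t.
Proof.
move=> xy s t; elim=> {s t} //=.
- by move=> s t u _ -> _ ->.
- by move=> s s' t t' _ -> _ ->.
- by move=> s s' t t' _ -> _ ->.
- by move=> s t u; rewrite addrA.
- by move=> s t; rewrite addrC.
- by move=> t; rewrite scale0r add0r.
- by move=> t; rewrite scale0r mulr_algl scaleN1r addNr.
- by move=> s t u; rewrite mulrA.
- by move=> t; rewrite scale1r mul1r.
- by move=> t; rewrite scale1r mulr1.
- by move=> s t u; rewrite mulrDl.
- by move=> s t u; rewrite mulrDr.
- by move=> a b; rewrite scalerDl.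
- by move=> a b; rewrite mulr_algl scalerA.
- by move=> a t; rewrite mulr_algl mulr_algr.
- by rewrite mulr_algl scaleN1r scale1r.
Qed.

Lemma weyl_lift_exists : x * y - y * x = 1 ->
  exists h : {lrmorphism weyl -> B}, h weyl_p = x /\ h weyl_q = y.
Proof.
move=> xy; pose h (a : weyl) := weval (repr a).
have hpi t : h (\pi_weyl t) = weval t by apply/(weval_weq xy)/weq_repr.
have hM a b : h (a * b) = h a * h b by rewrite -[a * b]/(wmul a b) hpi.
have h_lin : linear h.
  move=> c a b; rewrite -[_ + b]/(wadd _ b) hpi /=; congr (_ + _).
  by rewrite -[c *: a]/(wscal c * a) -/(h _) hM hpi /= mulr_algl.
have h_mon : monoid_morphism h.
  by split=> //; rewrite -[1]/(wscal 1) hpi /= scale1r.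
pose hA := GRing.isLinear.Build K weyl B *:%R h h_lin.
pose hB := GRing.isMonoidMorphism.Build weyl B h h_mon.
pose hL : {lrmorphism weyl -> B} := HB.pack h hA hB.
by exists hL; split; rewrite /= hpi.
Qed.

Lemma weyl_lift_unique (h h' : {lrmorphism weyl -> B}) :
  h weyl_p = h' weyl_p -> h weyl_q = h' weyl_q -> h =1 h'.
Proof.
move=> hp hq; elim/weyl_ind=> // [c|a b IHa IHb|a b IHa IHb].
- by rewrite !linearZ /= !rmorph1.
- by rewrite !rmorphD /= IHa IHb.
- by rewrite !rmorphM /= IHa IHb.
Qed.

End UniversalProperty.

End WeylQuotient.

Arguments weyl_p {K}.
Arguments weyl_q {K}.

(** * The Lie algebra sl(2) *)

Section CommutatorBracket.
Variables (K : fieldType) (A : algType K).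

Definition lie_bracket (a b : A) : A := a * b - b * a.

Lemma lie_bracketDl a b c :
  lie_bracket (a + b) c = lie_bracket a c + lie_bracket b c.
Proof. by rewrite /lie_bracket mulrDl mulrDr opprD addrACA. Qed.

Lemma lie_bracketDr a b c :
  lie_bracket a (b + c) = lie_bracket a b + lie_bracket a c.
Proof. by rewrite /lie_bracket mulrDl mulrDr opprD addrACA. Qed.

Lemma lie_bracketZl (k : K) a b : lie_bracket (k *: a) b = k *: lie_bracket a b.
Proof. by rewrite /lie_bracket -scalerAl -scalerAr scalerBr. Qed.

Lemma lie_bracketZr (k : K) a b : lie_bracket a (k *: b) = k *: lie_bracket a b.
Proof. by rewrite /lie_bracket -scalerAl -scalerAr scalerBr. Qed.

Lemma lie_bracketxx a : lie_bracket a a = 0.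
Proof. exact: subrr. Qed.

Lemma lie_bracket1l a : lie_bracket 1 a = 0.
Proof. by rewrite /lie_bracket mul1r mulr1 subrr. Qed.

Lemma lie_bracket1r a : lie_bracket a 1 = 0.
Proof. by rewrite /lie_bracket mul1r mulr1 subrr. Qed.

Lemma lie_bracketNr a b : lie_bracket a (- b) = - lie_bracket a b.
Proof. by rewrite -scaleN1r lie_bracketZr scaleN1r. Qed.

Lemma lie_bracketC a b : lie_bracket a b = - lie_bracket b a.
Proof. by rewrite /lie_bracket opprB. Qed.

Lemma lie_bracketMl a b c :
  lie_bracket (a * b) c = a * lie_bracket b c + lie_bracket a c * b.
Proof. by rewrite /lie_bracket mulrBr mulrBl !mulrA addrA subrK. Qed.

Lemma lie_bracketMr a b c :
  lie_bracket a (b * c) = lie_bracket a b * c + b * lie_bracket a c.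
Proof. by rewrite /lie_bracket mulrBr mulrBl !mulrA addrA subrK. Qed.

End CommutatorBracket.

Section Sl2.
Variable K : fieldType.

Definition traceless : {pred 'M[K]_2} := fun M => \tr M == 0.

Fact traceless_submod_closed : submod_closed traceless.
Proof.
split=> [|c M N]; rewrite !unfold_in ?mxtrace0 //.
by move=> /eqP trM /eqP trN; rewrite mxtraceD mxtraceZ trM trN mulr0 addr0.
Qed.

HB.instance Definition _ :=
  GRing.isSubmodClosed.Build K 'M[K]_2 traceless traceless_submod_closed.

Record sl2 : Type := Sl2 { sl2_val :> 'M[K]_2; _ : sl2_val \in traceless }.

HB.instance Definition _ := [isSub for sl2_val].
HB.instance Definition _ := [Choice of sl2 by <:].
HB.instance Definition _ := [SubChoice_isSubLmodule of sl2 by <:].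

Fact sl2_bracket_subproof (x y : sl2) : x *m y - y *m x \in traceless.
Proof. by rewrite unfold_in mxtraceD linearN /= mxtrace_mulC subrr. Qed.

Definition sl2_bracket (x y : sl2) : sl2 := Sl2 (sl2_bracket_subproof x y).

Fact e_plus_subproof : (delta_mx 0 1 : 'M[K]_2) \in traceless.
Proof. by rewrite unfold_in /mxtrace !big_ord_recl big_ord0 !mxE /= !addr0. Qed.

Fact e_minus_subproof : (delta_mx 1 0 : 'M[K]_2) \in traceless.
Proof. by rewrite unfold_in /mxtrace !big_ord_recl big_ord0 !mxE /= !addr0. Qed.

Fact e_zero_subproof : (delta_mx 0 0 - delta_mx 1 1 : 'M[K]_2) \in traceless.
Proof.
by rewrite unfold_in /mxtrace !big_ord_recl big_ord0 !mxE /= subr0 sub0r addr0 subrr.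
Qed.

Definition e_plus : sl2 := Sl2 e_plus_subproof.
Definition e_minus : sl2 := Sl2 e_minus_subproof.
Definition e_zero : sl2 := Sl2 e_zero_subproof.

Lemma sl2_coord11 (x : sl2) : (x : 'M_2) 1 1 = - (x : 'M_2) 0 0.
Proof.
case: x => M /=; rewrite unfold_in /mxtrace !big_ord_recl big_ord0 addr0.
by rewrite addrC addr_eq0 => /eqP <-; congr (M _ _); apply/val_inj.
Qed.

Lemma sl2_decomp (x : sl2) :
  x = (x : 'M_2) 0 1 *: e_plus + (x : 'M_2) 1 0 *: e_minus
      + (x : 'M_2) 0 0 *: e_zero.
Proof.
apply/val_inj/matrixP=> i j.
have ord2 (k : 'I_2) : k = 0 \/ k = 1.
  by case: k => [[|[|//]] ?]; [left|right]; apply/val_inj.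
rewrite /= !mxE.
case: (ord2 i) => ->; case: (ord2 j) => ->;
  by rewrite ?sl2_coord11 /= ?(subr0, sub0r, mulr0, mulr1, addr0, add0r, mulrN).
Qed.

(** The linear map sending [e_plus], [e_minus], [e_zero] to [u], [v], [h]. *)
Definition sl2_ext (V : lmodType K) (u v h : V) (x : sl2) : V :=
  (x : 'M_2) 0 1 *: u + (x : 'M_2) 1 0 *: v + (x : 'M_2) 0 0 *: h.

Fact sl2_ext_linear (V : lmodType K) (u v h : V) : linear (sl2_ext u v h).
Proof.
move=> c x y; rewrite /sl2_ext /= !mxE !scalerDl -!scalerA.
by rewrite !scalerDr [LHS](AC ((2*2)*2) ((1*3*5)*(2*4*6))).
Qed.

HB.instance Definition _ (V : lmodType K) (u v h : V) :=
  GRing.isLinear.Build K sl2 V *:%R (sl2_ext u v h) (sl2_ext_linear u v h).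

Lemma sl2_ext_plus (V : lmodType K) (u v h : V) : sl2_ext u v h e_plus = u.
Proof. by rewrite /sl2_ext /= !mxE /= scale1r !scale0r !addr0. Qed.

Lemma sl2_ext_minus (V : lmodType K) (u v h : V) : sl2_ext u v h e_minus = v.
Proof. by rewrite /sl2_ext /= !mxE /= scale1r !scale0r addr0 add0r. Qed.

Lemma sl2_ext_zero (V : lmodType K) (u v h : V) : sl2_ext u v h e_zero = h.
Proof. by rewrite /sl2_ext /= !mxE /= !subr0 scale1r !scale0r !add0r. Qed.

Section Sl2Triple.
Variables (A : algType K) (u v h : A).
Hypotheses (hu : lie_bracket h u = 2 *: u) (hv : lie_bracket h v = - 2 *: v).
Hypothesis uv : lie_bracket u v = h.

Lemma sl2_ext_bracket (x y : sl2) :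
  sl2_ext u v h (sl2_bracket x y)
  = lie_bracket (sl2_ext u v h x) (sl2_ext u v h y).
Proof.
have uh : lie_bracket u h = - 2 *: u by rewrite lie_bracketC hu scaleNr.
have vh : lie_bracket v h = 2 *: v by rewrite lie_bracketC hv scaleNr opprK.
have vu : lie_bracket v u = - h by rewrite lie_bracketC uv.
rewrite /sl2_ext !(lie_bracketDl, lie_bracketDr, lie_bracketZl, lie_bracketZr).
rewrite !lie_bracketxx uh vh vu hu hv uv /= !mxE !big_ord_recl !big_ord0.
have -> : lift ord0 ord0 = 1 :> 'I_2 by apply/val_inj.
rewrite !sl2_coord11 -[ord0]/(0 : 'I_2).
rewrite !scaler0 !scalerN !scalerA -!scaleNr !add0r !addr0.
rewrite [RHS](AC ((2*2)*2) ((2*5)*(4*6)*(1*3))) /= -!scalerDl.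
by congr (_ *: _ + _ *: _ + _ *: _); ring.
Qed.

Lemma sl2_ext_inj : (2 : K) != 0 -> v != 0 -> injective (sl2_ext u v h).
Proof.
move=> two_neq0 v_neq0.
have vh : lie_bracket v h = 2 *: v by rewrite lie_bracketC hv scaleNr opprK.
have vu : lie_bracket v u = - h by rewrite lie_bracketC uv.
suff ker0 x : sl2_ext u v h x = 0 -> x = 0.
  move=> x y /eqP; rewrite -subr_eq0 -linearB => /eqP /ker0 /eqP.
  by rewrite subr_eq0 => /eqP.
rewrite [in X in _ -> X](sl2_decomp x) /sl2_ext.
move: (fun_of_matrix x 0 1) (fun_of_matrix x 1 0) (fun_of_matrix x 0 0).
move=> a b c abc0.
have adv z : z = 0 -> lie_bracket v z = 0.
  by move=> ->; rewrite /lie_bracket mulr0 mul0r subrr.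
have scale_v0 k : k *: v = 0 -> k = 0.
  by move/eqP; rewrite scaler_eq0 (negPf v_neq0) orbF => /eqP.
have a0 : a = 0.
  have := adv _ abc0.
  rewrite !(lie_bracketDr, lie_bracketZr) lie_bracketxx vu vh scaler0 addr0.
  move/adv; rewrite -[- h]scaleN1r !(lie_bracketDr, lie_bracketZr) vh.
  rewrite lie_bracketxx !scaler0.
  rewrite !addr0 !scalerA mulrN1 mulNr => /scale_v0 /eqP.
  by rewrite oppr_eq0 mulf_eq0 (negPf two_neq0) orbF => /eqP.
rewrite a0 scale0r add0r in abc0 *.
have c0 : c = 0.
  have := adv _ abc0.
  rewrite !(lie_bracketDr, lie_bracketZr) lie_bracketxx scaler0 add0r vh scalerA.
  by move/scale_v0/eqP; rewrite mulf_eq0 (negPf two_neq0) orbF => /eqP.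
by move: abc0; rewrite c0 scale0r addr0 => /scale_v0 ->; rewrite !scale0r !addr0.
Qed.

End Sl2Triple.

End Sl2.

(** * Embeddings of sl(2) into the Weyl algebra *)

Section Embeddings.
Variable R : realType.
Local Notation C := R[i].
Local Notation A1 := (weyl C).
Local Notation sl2 := (sl2 C).
Local Notation p := (@weyl_p C).
Local Notation q := (@weyl_q C).

Record lie_emb : Type := LieEmb {
  lie_emb_fun :> {linear sl2 -> A1};
  lie_emb_bracket : forall x y,
    lie_emb_fun (sl2_bracket x y) = lie_bracket (lie_emb_fun x) (lie_emb_fun y);
  lie_emb_inj : injective lie_emb_fun
}.

Lemma lie_emb_ext (f g : lie_emb) : f =1 g -> f = g.
Proof.
case: f g => [f fM f_inj] [g gM g_inj] /= fg.
have {}fg : f = g.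
  case: f g {fM f_inj gM g_inj} fg => [f [[f1] [f2]]] [g [[g1] [g2]]] /= fg.
  have {fg} fg : f = g by apply/funext.
  by subst g; congr GRing.Linear.Pack; rewrite (Prop_irrelevance f1 g1)
    (Prop_irrelevance f2 g2).
by subst g; rewrite (Prop_irrelevance fM gM) (Prop_irrelevance f_inj g_inj).
Qed.

Record aut_A1 : Type := AutA1 {
  aut_A1_fun :> {lrmorphism A1 -> A1};
  aut_A1_bij : bijective aut_A1_fun
}.

(** The inverse is carried as data; it is determined by the automorphism. *)
Record aut_sl2 : Type := AutSl2 {
  aut_sl2_fun :> {linear sl2 -> sl2};
  aut_sl2_inv : sl2 -> sl2;
  aut_sl2_bracket : forall x y,
    aut_sl2_fun (sl2_bracket x y) = sl2_bracket (aut_sl2_fun x) (aut_sl2_fun y);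
  aut_sl2_funK : cancel aut_sl2_fun aut_sl2_inv;
  aut_sl2_invK : cancel aut_sl2_inv aut_sl2_fun
}.

Fact aut_sl2_inv_linear (w : aut_sl2) : linear (aut_sl2_inv w).
Proof. exact: can2_linear (@aut_sl2_funK w) (@aut_sl2_invK w). Qed.

HB.instance Definition _ (w : aut_sl2) :=
  GRing.isLinear.Build C sl2 sl2 *:%R (aut_sl2_inv w) (aut_sl2_inv_linear w).

(** [(a, w) . f = a o f o w^-1] *)
Definition act_fun (aw : aut_A1 * aut_sl2) (f : lie_emb) : {linear sl2 -> A1} :=
  aw.1 \o f \o aut_sl2_inv aw.2.

Fact act_bracket aw f x y :
  act_fun aw f (sl2_bracket x y) = lie_bracket (act_fun aw f x) (act_fun aw f y).
Proof.
case: aw => a w /=.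
have -> : aut_sl2_inv w (sl2_bracket x y)
          = sl2_bracket (aut_sl2_inv w x) (aut_sl2_inv w y).
  apply: (can_inj (@aut_sl2_funK w)).
  by rewrite aut_sl2_bracket !aut_sl2_invK.
by rewrite lie_emb_bracket /lie_bracket rmorphB !rmorphM.
Qed.

Fact act_inj aw f : injective (act_fun aw f).
Proof.
case: aw => a w /=; apply: inj_comp; last exact: can_inj (@aut_sl2_invK w).
by apply: inj_comp (@lie_emb_inj f); apply: bij_inj (@aut_A1_bij a).
Qed.

Definition act (aw : aut_A1 * aut_sl2) (f : lie_emb) : lie_emb :=
  LieEmb (@act_bracket aw f) (@act_inj aw f).

Definition same_orbit (f g : lie_emb) : Prop :=
  exists aw : aut_A1 * aut_sl2, act aw f = g.

Let two_neq0 : (2 : C) != 0.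
Proof. by rewrite pnatr_eq0. Qed.

Let pq : lie_bracket p q = 1.
Proof. exact: weyl_relation. Qed.

Let qp : lie_bracket q p = - 1.
Proof. by rewrite lie_bracketC pq. Qed.

Let add4 (x : A1) : x + x + (x + x) = 4 *: x.
Proof. by rewrite -!mulr2n -mulrnA scaler_nat. Qed.

Let half2 : (2^-1 * 2 : C) = 1.
Proof. exact: mulVf. Qed.

Definition I_plus : A1 := - 2^-1 *: q ^+ 2.
Definition I_minus : A1 := 2^-1 *: p ^+ 2.
Definition I_zero : A1 := 2^-1 *: (p * q + q * p).

Fact I_zero_plus : lie_bracket I_zero I_plus = 2 *: I_plus.
Proof.
rewrite /I_zero /I_plus expr2 lie_bracketZl lie_bracketZr lie_bracketDl.
rewrite !lie_bracketMl !lie_bracketMr ?pq ?qp ?lie_bracketxx.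
rewrite !(mulr0, mul0r, add0r, addr0, mul1r, mulr1, mulN1r, mulrN1).
by rewrite mulrDl mulrDr add4 !scalerA; congr (_ *: _); field; rewrite ?two_neq0 ?oner_neq0.
Qed.

Fact I_zero_minus : lie_bracket I_zero I_minus = - 2 *: I_minus.
Proof.
rewrite /I_zero /I_minus expr2 lie_bracketZl lie_bracketZr lie_bracketDl.
rewrite !lie_bracketMl !lie_bracketMr ?pq ?qp ?lie_bracketxx.
rewrite !(mulr0, mul0r, add0r, addr0, mul1r, mulr1, mulN1r, mulrN1).
rewrite mulrDl mulrDr !(mulNr, mulrN) add4 -scaleN1r.
by rewrite !scalerA; congr (_ *: _); field; rewrite ?two_neq0 ?oner_neq0.
Qed.

Fact I_plus_minus : lie_bracket I_plus I_minus = I_zero.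
Proof.
rewrite /I_zero /I_plus /I_minus !expr2 lie_bracketZl lie_bracketZr.
rewrite !lie_bracketMl !lie_bracketMr ?pq ?qp ?lie_bracketxx.
rewrite !(mulr0, mul0r, add0r, addr0, mul1r, mulr1, mulN1r, mulrN1).
rewrite mulrDl mulrDr !(mulNr, mulrN) -!opprD !scalerN scaleNr opprK.
rewrite addrACA -mulr2n (addrC (p * q)).
by rewrite -[(_ + _) *+ 2]scaler_nat (scalerA _ 2) half2 scale1r.
Qed.

Fact I_minus_neq0 : I_minus != 0.
Proof.
rewrite /I_minus scaler_eq0 invr_eq0 (negPf two_neq0) /=.
apply/eqP=> /(congr1 (@weyl_act C ^~ 'X^2)) /eqP.
rewrite expr2 weyl_actM !weyl_act_p weyl_act0 derivXn expr1 derivMn derivX.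
by rewrite -polyC1 -polyCMn polyC_eq0 (negPf two_neq0).
Qed.

Definition f_I : lie_emb :=
  @LieEmb (sl2_ext I_plus I_minus I_zero)
    (sl2_ext_bracket I_zero_plus I_zero_minus I_plus_minus)
    (sl2_ext_inj I_zero_minus I_plus_minus two_neq0 I_minus_neq0).

Definition II_plus (b : C) : A1 := (b%:A + p * q) * q.
Definition II_minus : A1 := - p.
Definition II_zero (b : C) : A1 := 2 *: (p * q) + b%:A.

Fact II_zero_plus b : lie_bracket (II_zero b) (II_plus b) = 2 *: II_plus b.
Proof.
rewrite /II_zero /II_plus lie_bracketDl !lie_bracketZl lie_bracket1l.
rewrite scaler0 addr0; congr (_ *: _).
rewrite lie_bracketMr lie_bracketDr lie_bracketZr lie_bracket1r lie_bracketxx.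
rewrite scaler0 addr0 mul0r add0r lie_bracketMl pq lie_bracketxx.
by rewrite mulr0 mul1r add0r.
Qed.

Fact II_zero_minus b : lie_bracket (II_zero b) II_minus = - 2 *: II_minus.
Proof.
rewrite /II_zero /II_minus lie_bracketDl !lie_bracketZl lie_bracket1l.
rewrite scaler0 addr0 lie_bracketNr lie_bracketMl qp lie_bracketxx mul0r addr0.
by rewrite mulrN1 opprK scaleNr scalerN opprK.
Qed.

Fact II_plus_minus b : lie_bracket (II_plus b) II_minus = II_zero b.
Proof.
rewrite /II_zero /II_plus /II_minus lie_bracketNr lie_bracketMl qp.
rewrite lie_bracketDl lie_bracketZl lie_bracket1l scaler0 add0r.
rewrite lie_bracketMl qp lie_bracketxx mul0r addr0 !mulrN1 mulNr opprD !opprK.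
by rewrite -addrA addrC scaler_nat mulr2n.
Qed.

Fact II_minus_neq0 : II_minus != 0.
Proof.
rewrite /II_minus oppr_eq0; apply/eqP=> /(congr1 (@weyl_act C ^~ 'X)) /eqP.
by rewrite weyl_act_p weyl_act0 derivX oner_eq0.
Qed.

Definition f_II (b : C) : lie_emb :=
  @LieEmb (sl2_ext (II_plus b) II_minus (II_zero b))
    (sl2_ext_bracket (II_zero_plus b) (II_zero_minus b) (II_plus_minus b))
    (sl2_ext_inj (II_zero_minus b) (II_plus_minus b) two_neq0 II_minus_neq0).

Definition normal_forms : set lie_emb := [set f_I] `|` range f_II.

End Embeddings.

(* Main.v *)
Require Import Defs.
From mathcomp Require Import reals.
From mathcomp Require Import all_boot all_order all_algebra.
From mathcomp Require Import boolp classical_sets complex ring.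

(** The invariant that separates the orbits is local ad-nilpotence: an element
    [u] of the Weyl algebra is locally ad-nilpotent if every [y] is killed by
    some power of [ad u].  Automorphisms of the algebra preserve this property
    ([ad_nil_bij]), so an equivalence [a \o f \o w^-1 = g] matches the [x] in
    sl(2) for which [f x] is locally ad-nilpotent with those for which [g x] is.

    For [f_I] these [x] include both [e_plus] and [e_minus], whose images are
    multiples of [q ^+ 2] and [p ^+ 2].  For [f_II b] they all lie on the line
    spanned by [e_minus]: the inner derivation by [f_II b x] acts on polynomials
    in [q] as a vector field [A(q) d/dq], where [A] is a quadratic polynomial
    whose coefficients are the coordinates of [x], and such a field is locally
    nilpotent only if [A] is constant ([ad_nil_II]).  A linear injection
    cannot send two independent vectors to one line, so [f_I] is not equivalent
    to any [f_II b] ([not_ad_nil_I_II]).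

    If [f_II b] is equivalent to [f_II b'] through [a] and [w], then [v = w^-1]
    preserves the line of [e_minus], say [v e_minus = c *: e_minus], and the
    relation [[e_zero, e_minus] = -2 *: e_minus] forces
    [v e_zero = e_zero + d *: e_minus].  Hence [a p] is a scalar multiple of
    [p], and comparing the images of [e_zero] shows that the scalar [b - b'] is
    a right multiple of [p].  As [p] has no right inverse ([weyl_pM_scalar]),
    [b = b'] ([II_param_unique]).  The Casimir element would not suffice here:
    it takes the same value on [f_II b] and [f_II (- 2 - b)]. *)

Set Implicit Arguments.
Unset Strict Implicit.
Unset Printing Implicit Defensive.

Import GRing.Theory Num.Theory.
Local Open Scope ring_scope.

(** * Locally ad-nilpotent elements *)

Section AdNilpotent.
Variables (K : fieldType) (A : algType K).
Implicit Types u x y : A.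

Definition ad_nil_on u y : Prop := exists n, iter n (lie_bracket u) y = 0.

Definition ad_nil u : Prop := forall y, ad_nil_on u y.

Lemma iter_ad0 u n : iter n (lie_bracket u) 0 = 0.
Proof. by elim: n => //= n ->; rewrite /lie_bracket mulr0 mul0r subrr. Qed.

Lemma iter_adD u n x y : iter n (lie_bracket u) (x + y)
  = iter n (lie_bracket u) x + iter n (lie_bracket u) y.
Proof. by elim: n => //= n ->; rewrite lie_bracketDr. Qed.

Lemma iter_adZ u (c : K) n y :
  iter n (lie_bracket (c *: u)) y = c ^+ n *: iter n (lie_bracket u) y.
Proof.
elim: n => [|n /= ->]; first by rewrite scale1r.
by rewrite lie_bracketZl lie_bracketZr scalerA exprS.
Qed.

(** By the Leibniz rule, each term of [(ad u)^(m + n) (x * y)] contains a factor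
    [(ad u)^m x] or [(ad u)^n y]. *)
Lemma iter_adM u m n x y :
  iter m (lie_bracket u) x = 0 -> iter n (lie_bracket u) y = 0 ->
  iter (m + n) (lie_bracket u) (x * y) = 0.
Proof.
elim: m x n y => [|m IHm] x; first by move=> n y /= -> _; rewrite mul0r iter_ad0.
elim=> [|n IHn] y; first by move=> _ y0; rewrite (y0 : y = 0) mulr0 iter_ad0.
move=> x0 y0; rewrite addSn iterSr lie_bracketMr iter_adD.
have -> : iter (m + n.+1) (lie_bracket u) (lie_bracket u x * y) = 0.
  by apply: IHm; rewrite // -iterSr.
by rewrite add0r addnS -addSn; apply: IHn; rewrite // -iterSr.
Qed.

Lemma ad_nil_onD u x y :
  ad_nil_on u x -> ad_nil_on u y -> ad_nil_on u (x + y).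
Proof.
move=> [m x0] [n y0]; exists (m + n)%N.
by rewrite iter_adD addnC iterD x0 iter_ad0 addnC iterD y0 iter_ad0 addr0.
Qed.

Lemma ad_nil_onM u x y :
  ad_nil_on u x -> ad_nil_on u y -> ad_nil_on u (x * y).
Proof. by move=> [m x0] [n y0]; exists (m + n)%N; apply: iter_adM. Qed.

Lemma ad_nil_scale u (c : K) : ad_nil u -> ad_nil (c *: u).
Proof.
by move=> nu y; have [n y0] := nu y; exists n; rewrite iter_adZ y0 scaler0.
Qed.

Lemma ad_nil_bij (a : {rmorphism A -> A}) u :
  bijective a -> ad_nil (a u) <-> ad_nil u.
Proof.
move=> a_bij.
have iter_a n y :
    iter n (lie_bracket (a u)) (a y) = a (iter n (lie_bracket u) y).
  by elim: n => //= n ->; rewrite /lie_bracket rmorphB !rmorphM.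
split=> nil_u y.
  have [n] := nil_u (a y); rewrite iter_a => ay0; exists n.
  by apply: (bij_inj a_bij); rewrite rmorph0.
have [a' _ aK] := a_bij; have [n y0] := nil_u (a' y).
by exists n; rewrite -(aK y) iter_a y0 rmorph0.
Qed.

End AdNilpotent.

(** * The Weyl algebra acting on polynomials *)

Section Weyl.
Variable K : numFieldType.
Local Notation A1 := (weyl K).
Local Notation p := (@weyl_p K).
Local Notation q := (@weyl_q K).
Implicit Types (f g A : {poly K}) (u y : A1).

(** The elements killed by a power of [ad u] form a subalgebra, so it is enough
    to look at the generators. *)
Lemma ad_nil_gen u : ad_nil_on u p -> ad_nil_on u q -> ad_nil u.
Proof.
move=> up uq; elim/weyl_ind => // [c|x y|x y]; last exact: ad_nil_onM.
  by exists 1%N; rewrite /= lie_bracketZr lie_bracket1r scaler0.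
exact: ad_nil_onD.
Qed.

Lemma lie_pq : lie_bracket p q = 1.
Proof. exact: weyl_relation. Qed.

Lemma lie_qp : lie_bracket q p = -1.
Proof. by rewrite lie_bracketC lie_pq. Qed.

Lemma ad_nil_p : ad_nil p.
Proof.
apply: ad_nil_gen; first by exists 1%N; apply: lie_bracketxx.
by exists 2%N; rewrite /= lie_pq lie_bracket1r.
Qed.

Lemma ad_nil_p2 : ad_nil (p ^+ 2).
Proof.
have p2p : lie_bracket (p ^+ 2) p = 0.
  by rewrite expr2 lie_bracketMl lie_bracketxx mulr0 mul0r addr0.
apply: ad_nil_gen; first by exists 1%N.
have p2q : lie_bracket (p ^+ 2) q = p + p.
  by rewrite expr2 lie_bracketMl lie_pq mulr1 mul1r.
by exists 2%N; rewrite /= p2q lie_bracketDr p2p addr0.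
Qed.

Lemma ad_nil_q2 : ad_nil (q ^+ 2).
Proof.
have q2q : lie_bracket (q ^+ 2) q = 0.
  by rewrite expr2 lie_bracketMl lie_bracketxx mulr0 mul0r addr0.
apply: ad_nil_gen; last by exists 1%N.
have q2p : lie_bracket (q ^+ 2) p = - q - q.
  by rewrite expr2 lie_bracketMl lie_qp mulrN1 mulN1r.
by exists 2%N; rewrite /= q2p lie_bracketDr !lie_bracketNr q2q oppr0 addr0.
Qed.

Local Notation ev := (horner_alg q).

Lemma weyl_act1 f : weyl_act (1 : A1) f = f.
Proof.
by rewrite (_ : (1 : A1) = \pi_(weyl K)%qT (WScal 1)) // weyl_act_pi /= scale1r.
Qed.

(** Acting on 1 recovers a polynomial from its value at [q], so the polynomials
    in [q] are a faithful copy of [{poly K}] inside the Weyl algebra. *)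
Lemma weyl_act_ev f : weyl_act (ev f) 1 = f.
Proof.
elim/poly_ind: f => [|f c IHf]; first by rewrite rmorph0 weyl_act0.
rewrite rmorphD /= weyl_actD; congr (_ + _).
  rewrite mulrC rmorphM /= horner_algX weyl_actM IHf weyl_act_q.
  by rewrite mulrC.
by rewrite horner_algC weyl_actZ weyl_act1 alg_polyC.
Qed.

Lemma lie_q_ev f : lie_bracket q (ev f) = 0.
Proof.
elim/poly_ind: f => [|f c IHf].
  by rewrite rmorph0 /lie_bracket mulr0 mul0r subrr.
rewrite rmorphD rmorphM /= horner_algX horner_algC lie_bracketDr lie_bracketMr.
rewrite IHf lie_bracketxx lie_bracketZr lie_bracket1r.
by rewrite mul0r mulr0 scaler0 !addr0.
Qed.

Lemma lie_p_ev f : lie_bracket p (ev f) = ev f^`().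
Proof.
elim/poly_ind: f => [|f c IHf].
  by rewrite deriv0 rmorph0 /lie_bracket mulr0 mul0r subrr.
rewrite rmorphD rmorphM /= horner_algX horner_algC lie_bracketDr lie_bracketMr.
rewrite IHf lie_pq lie_bracketZr lie_bracket1r scaler0 addr0 mulr1.
by rewrite derivD derivM derivX derivC addr0 mulr1 rmorphD rmorphM /= horner_algX.
Qed.

(** If [A] is not constant, then in characteristic 0 the vector field [A d/dX]
    does not lower the degree, except on constants. *)
Lemma size_deriv_iter_gt1 A f n : (1 < size A)%N -> (1 < size f)%N ->
  (1 < size (iter n (fun g => (A * g^`())%R) f))%N.
Proof.
move=> A1 f1; elim: n => //= n; set g := iter _ _ _ => g1.
have g'0 : g^`() != 0.
  apply: contraTneq g1 => /(congr1 (fun h : {poly K} => h`_(size g).-2)) /eqP.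
  (* the coefficient examined is the leading one of [g], times its degree *)
  rewrite coef_deriv coef0 mulrn_eq0 /=.
  case sg : (size g) => [|[|m]] //= /eqP.
  move=> gm; have : lead_coef g = 0 by rewrite lead_coefE sg.
  by move/eqP; rewrite lead_coef_eq0 => /eqP g0; rewrite g0 size_poly0 in sg.
have A0 : A != 0 by rewrite -size_poly_gt0 (leq_trans _ A1).
rewrite size_mul //; move: g'0; rewrite -size_poly_gt0.
by case: (size g^`()) => // m _; rewrite addnS (leq_trans A1) ?leq_addr.
Qed.

(** Iterating the vector field on [q] itself never gives 0 unless [A] is
    constant. *)
Lemma ad_nil_vector_field u A :
  (forall f, lie_bracket u (ev f) = ev (A * f^`())) -> ad_nil u ->
  (size A <= 1)%N.
Proof.
move=> uA nil_u; rewrite leqNgt; apply/negP=> A1.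
have [n] := nil_u (ev 'X).
have -> : iter n (lie_bracket u) (ev 'X)
          = ev (iter n (fun g => A * g^`()) 'X).
  by elim: n => //= n ->.
move/(congr1 ((@weyl_act K)^~ 1)); rewrite weyl_act_ev weyl_act0 => it0.
have := @size_deriv_iter_gt1 A 'X n A1.
by rewrite it0 size_polyX size_poly0 => /(_ isT).
Qed.

(** The Fourier automorphism [p |-> q], [q |-> - p] turns [p * y] into
    [q * y'], which sends the polynomial 1 to a multiple of ['X]. *)
Lemma weyl_pM_scalar y (c : K) : p * y = c%:A -> c = 0.
Proof.
have [F [Fp Fq]] : exists F : {lrmorphism A1 -> A1}, F p = q /\ F q = - p.
  apply: weyl_lift_exists; rewrite mulrN mulNr opprK addrC.
  exact: weyl_relation.
move=> /(congr1 F); rewrite rmorphM linearZ /= rmorph1 Fp.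
move/(congr1 ((@weyl_act K)^~ 1)).
rewrite weyl_actM weyl_act_q weyl_actZ weyl_act1 alg_polyC => /(congr1 (horner^~ 0)).
by rewrite hornerM hornerX mul0r hornerC.
Qed.

(** * The two families of embeddings *)

Local Notation ep := (e_plus K).
Local Notation em := (e_minus K).
Local Notation e0 := (e_zero K).
Implicit Types (z : sl2 K) (b : K).

(** [emb_I] and [emb_II] are the functions underlying [f_I] and [f_II]; only
    characteristic 0 matters for them, so the base field is any numeric field. *)
Definition emb_I : sl2 K -> A1 :=
  sl2_ext (- 2^-1 *: q ^+ 2) (2^-1 *: p ^+ 2) (2^-1 *: (p * q + q * p)).

Definition emb_II b : sl2 K -> A1 :=
  sl2_ext ((b%:A + p * q) * q) (- p) (2 *: (p * q) + b%:A).

Lemma ad_nil_I_plus : ad_nil (emb_I ep).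
Proof. by rewrite /emb_I sl2_ext_plus; apply/ad_nil_scale/ad_nil_q2. Qed.

Lemma ad_nil_I_minus : ad_nil (emb_I em).
Proof. by rewrite /emb_I sl2_ext_minus; apply/ad_nil_scale/ad_nil_p2. Qed.

Lemma ad_nil_II_minus b : ad_nil (emb_II b em).
Proof.
by rewrite /emb_II sl2_ext_minus -scaleN1r; apply/ad_nil_scale/ad_nil_p.
Qed.

(** As differential operators in [q], [e_plus], [e_minus] and [e_zero] act with
    symbols [q^2 d/dq], [- d/dq] and [2 q d/dq]; the terms of order 0 commute
    with [ev f]. *)
Lemma lie_II_ev b z f :
  lie_bracket (emb_II b z) (ev f)
  = ev ((z 0 1 *: 'X^2 - (z 1 0)%:P + (2 * z 0 0) *: 'X) * f^`()).
Proof.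
have pqf : lie_bracket (p * q) (ev f) = ev ('X * f^`()).
  rewrite lie_bracketMl lie_q_ev mulr0 add0r lie_p_ev.
  by rewrite mulrC rmorphM /= horner_algX.
have plus : lie_bracket ((b%:A + p * q) * q) (ev f) = ev ('X^2 * f^`()).
  rewrite lie_bracketMl lie_q_ev mulr0 add0r lie_bracketDl.
  rewrite lie_bracketZl lie_bracket1l scaler0 add0r pqf.
  by rewrite expr2 -mulrA [in RHS]mulrC [RHS]rmorphM /= horner_algX.
have minus : lie_bracket (- p) (ev f) = - ev f^`().
  by rewrite -scaleN1r lie_bracketZl lie_p_ev scaleN1r.
have zero : lie_bracket (2 *: (p * q) + b%:A) (ev f) = 2 *: ev ('X * f^`()).
  by rewrite lie_bracketDl !lie_bracketZl lie_bracket1l scaler0 addr0 pqf.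
(* the explicit argument keeps [- p] from being read as a scalar multiple *)
rewrite /emb_II /sl2_ext !lie_bracketDl !(lie_bracketZl (fun_of_matrix z _ _)).
rewrite plus minus zero.
rewrite 2!mulrDl mulNr mul_polyC -!scalerAl 2!rmorphD rmorphN /=.
have evZ c g : ev (c *: g) = c *: ev g by rewrite linearZ /= mulr_algl.
by rewrite !evZ scalerN scalerA (mulrC 2).
Qed.

(** The symbol has to be constant, which kills the coefficients along [e_plus]
    and [e_zero]. *)
Lemma ad_nil_II b z : ad_nil (emb_II b z) -> z = z 1 0 *: em.
Proof.
move=> /(ad_nil_vector_field (@lie_II_ev b z)) sA.
have coefA i := nth_default 0 (leq_trans sA (ltn0Sn i)).
have z01 : z 0 1 = 0.
  by have := coefA 1%N; rewrite !coefE /= mulr1 mulr0 subr0 addr0.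
have z00 : z 0 0 = 0.
  have := coefA 0%N; rewrite !coefE /= mulr0 mulr1 subr0 add0r => /eqP.
  by rewrite mulf_eq0 pnatr_eq0 => /eqP.
by rewrite {1}(sl2_decomp z) z01 z00 !scale0r add0r addr0.
Qed.

(** Such a [v] would send [e_plus] and [e_minus] to the same line. *)
Lemma not_ad_nil_I_II b (v : {linear sl2 K -> sl2 K}) : injective v ->
  ~ (forall z, ad_nil (emb_I z) -> ad_nil (emb_II b (v z))).
Proof.
move=> v_inj nil_v.
have /ad_nil_II vp := nil_v _ ad_nil_I_plus.
have /ad_nil_II vm := nil_v _ ad_nil_I_minus.
move: (v ep 1 0) (v em 1 0) vp vm => a c vp vm.
have /v_inj /(congr1 val) /matrixP ac : v (c *: ep) = v (a *: em).
  by rewrite !linearZ /= vp vm !scalerA mulrC.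
have c0 : c = 0 by have := ac 0 1; rewrite !mxE /= mulr1 mulr0.
move: vm; rewrite c0 scale0r -(linear0 v).
move=> /v_inj /(congr1 val) /matrixP /(_ 1 0).
by rewrite !mxE /= => /eqP; rewrite oner_eq0.
Qed.

Lemma sl2_bracket_e_minusZ z (c : K) :
  sl2_bracket z (c *: em) = (c * z 0 1) *: e0 - (2 * c * z 0 0) *: em.
Proof.
have ord2 (k : 'I_2) : k = 0 \/ k = 1.
  by case: k => [[|[|//]] ?]; [left|right]; apply/val_inj.
have lift01 : lift ord0 ord0 = 1 :> 'I_2 by apply/val_inj.
apply/val_inj/matrixP=> i j.
rewrite /= !mxE !big_ord_recl !big_ord0 !mxE lift01 -[ord0]/(0 : 'I_2).
by case: (ord2 i) => ->; case: (ord2 j) => ->; rewrite /= ?sl2_coord11; ring.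
Qed.

(** Up to rescaling, [a] fixes [p]; what remains of the image of [e_zero] is an
    equation between right multiples of [p] and the constant [b - b']. *)
Lemma II_param_unique b b' (a : {lrmorphism A1 -> A1})
    (v : {linear sl2 K -> sl2 K}) :
  bijective a -> injective v ->
  (forall z z', v (sl2_bracket z z') = sl2_bracket (v z) (v z')) ->
  (forall z, a (emb_II b (v z)) = emb_II b' z) -> b = b'.
Proof.
move=> a_bij v_inj vB aE.
have : ad_nil (a (emb_II b (v em))) by rewrite aE; apply: ad_nil_II_minus.
move=> /(ad_nil_bij _ a_bij) /ad_nil_II vm.
move: (v em 1 0) vm => c vm.
have c0 : c != 0.
  apply/eqP=> c0; move: vm; rewrite c0 scale0r -(linear0 v).
  move=> /v_inj /(congr1 val) /matrixP /(_ 1 0).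
  by rewrite !mxE /= => /eqP; rewrite oner_eq0.
have e0m : sl2_bracket e0 em = - 2 *: em.
  rewrite -[em in LHS]scale1r sl2_bracket_e_minusZ !mxE /= !subr0 mulr0 !mulr1.
  by rewrite scale0r sub0r scaleNr.
have := vB e0 em; have := aE e0.
rewrite e0m linearZ /= vm sl2_bracket_e_minusZ; move: (v e0) => x ax.
move=> /(congr1 val) /matrixP /= v0m.
have x01 : x 0 1 = 0.
  have := v0m 0 0; rewrite !mxE /= !mulr0 !subr0 mulr1 => /esym/eqP.
  by rewrite mulf_eq0 (negPf c0) => /eqP.
have x00 : x 0 0 = 1.
  have := v0m 1 0; rewrite !mxE /= subrr mulr0 sub0r !mulr1 mulNr => /oppr_inj.
  rewrite -[LHS]mulr1 => /mulfI -> //.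
  by rewrite mulf_neq0 // pnatr_eq0.
have := aE em; rewrite vm /emb_II linearZ linearZ /= !sl2_ext_minus.
rewrite rmorphN scalerN => /oppr_inj ap.
have {}ap : a p = c^-1 *: p by rewrite -{2}ap scalerA mulVf // scale1r.
move: ax; rewrite (sl2_decomp x) x01 x00 /emb_II scale0r add0r scale1r.
rewrite sl2_ext_linear sl2_ext_minus !sl2_ext_zero 2!rmorphD /=.
rewrite linearZ rmorphN 2!linearZ /= rmorphM rmorph1 /= ap => ax.
apply/eqP; rewrite -subr_eq0; apply/eqP.
(* [ax] says that [b - b'] is [p] times this cofactor *)
apply: (@weyl_pM_scalar (2 *: q + (x 1 0 / c)%:A - (2 / c) *: a q)).
rewrite mulrBr mulrDr -!scalerAr mulr1 scalerBl.
move/eqP: ax; rewrite [X in _ == X]addrC -subr_eq => /eqP <-.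
rewrite scalerN -scalerAl !scalerA !opprD !opprK.
by rewrite [RHS](AC (1*((1*(1*1))*1)) ((5*2*3)*(1*4))) /= subrr addr0.
Qed.

End Weyl.

Theorem proposition5p12 (R : realType) (f g : lie_emb R) :
  normal_forms f -> normal_forms g -> f <> g -> ~ same_orbit f g.
Proof.
move=> [->|[b _ <-]] [->|[b' _ <-]] // fg [[a w] awE].
- apply: (@not_ad_nil_I_II _ b' (aut_sl2_fun w)).
    exact: can_inj (@aut_sl2_funK _ w).
  move=> z; rewrite -[emb_II _ _]/(f_II b' (w z)) -awE /= aut_sl2_funK.
  by move/(ad_nil_bij _ (aut_A1_bij a)).
- apply: (@not_ad_nil_I_II _ b (aut_sl2_inv w)).
    exact: can_inj (@aut_sl2_invK _ w).
  move=> z; rewrite -[emb_I _]/(f_I R z) -awE.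
  by move/(ad_nil_bij _ (aut_A1_bij a)).
- apply: fg; congr f_II.
  apply: (@II_param_unique _ _ _ a (aut_sl2_inv w)).
  + exact: aut_A1_bij.
  + exact: can_inj (@aut_sl2_invK _ w).
  + move=> x y; apply: (can_inj (@aut_sl2_funK _ w)).
    by rewrite aut_sl2_bracket !aut_sl2_invK.
  + by move=> z; rewrite -[RHS]/(f_II b' z) -awE.
Qed.
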